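(* (i) If $G$ is an $r$-tonal graph, where $r$ is an integer with $0<r\le\lfloor e(G)/2\rfloor$, then ${\rm bal}_r(n,G)=\mathcal{O}(n^{2-\frac1m})$ as $n\to\infty$, where $m=m(G)$ is a positive integer depending only on $G$. In particular, if $G$ is balanceable, then ${\rm bal}(n,G)=\mathcal{O}(n^{2-\frac1m})$ with $m=m(G)$ depending only on $G$. (ii) If $G$ is omnitonal, then ${\rm ot}(n,G)=\mathcal{O}(n^{2-\frac1m})$, where $m=m(G)$ is a positive integer depending only on $G$.
   Context: Graphs are finite and simple; $e(G)=|E(G)|$. A $2$-coloring $E(K_n)=E(R)\cup E(B)$ is a partition of the edges of $K_n$ into red edges (forming $R$) and blue edges (forming $B$). An $(r,b)$-colored copy of $G$ (with $r+b=e(G)$) is a (not necessarily induced) subgraph of $K_n$ isomorphic to $G$ with exactly $r$ red and $b$ blue edges. For $0<r\le\lfloor e(G)/2\rfloor$, ${\rm bal}_r(n,G)$ is the minimum non-negative integer $s$ such that every $2$-coloring with $\min\{e(R),e(B)\}>s$ contains an $(r,e(G)-r)$-colored copy or an $(e(G)-r,r)$-colored copy of $G$. ${\rm bal}(n,G)$ is the minimum non-negative integer $s$ such that every $2$-coloring with $\min\{e(R),e(B)\}>s$ contains a $(\lceil e(G)/2\rceil,\lfloor e(G)/2\rfloor)$-colored or a $(\lfloor e(G)/2\rfloor,\lceil e(G)/2\rceil)$-colored copy of $G$. ${\rm ot}(n,G)$ is the minimum non-negative integer $s$ such that every $2$-coloring with $\min\{e(R),e(B)\}>s$ contains an $(r,b)$-colored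 copy of $G$ for every pair of integers $r,b\ge0$ with $r+b=e(G)$. $G$ is $r$-tonal (respectively balanceable, omnitonal) if for every sufficiently large $n$ the integer ${\rm bal}_r(n,G)$ (respectively ${\rm bal}(n,G)$, ${\rm ot}(n,G)$) exists non-vacuously, that is, it is less than $\lfloor\frac12\binom n2\rfloor$, so that colorings with more than that many edges of each color exist. *)

(* Defs.v *)
From mathcomp Require Import all_boot.

Set Implicit Arguments.
Unset Strict Implicit.
Unset Printing Implicit Defensive.

Definition complete_edges (T : finType) : {set {set T}} :=
  [set e : {set T} | #|e| == 2].

(* Finite simple graphs: edges are two-element sets of vertices. *)
Record sgraph := SGraph {
  vertex : finType;
  edges : {set {set vertex}};
  edgesP : edges \subset complete_edges vertex }.

Definition esize (G : sgraph) : nat := #|edges G|.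

Definition two_coloring (n : nat) (R B : {set {set 'I_n}}) : bool :=
  (R :|: B == complete_edges 'I_n) && [disjoint R & B].

(* Edge set of the image of G under f; for f injective, these images are
   exactly the subgraphs of K_n isomorphic to G. *)
Definition copy_edges (G : sgraph) (n : nat) (f : {ffun vertex G -> 'I_n}) :
    {set {set 'I_n}} :=
  [set f @: (e : {set vertex G}) | e in edges G].

Definition has_colored_copy (G : sgraph) (n : nat) (R B : {set {set 'I_n}})
    (r b : nat) : bool :=
  [exists f : {ffun vertex G -> 'I_n},
    [&& injectiveb f, #|copy_edges f :&: R| == r & #|copy_edges f :&: B| == b]].

Definition forced (n : nat) (P : {set {set 'I_n}} -> {set {set 'I_n}} -> bool)
    (s : nat) : bool :=
  [forall R : {set {set 'I_n}}, forall B : {set {set 'I_n}},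
    two_coloring R B ==> (s < minn #|R| #|B|) ==> P R B].

(* The minimum defining bal_r, bal and ot ranges over a nonempty set, because
   the condition holds vacuously for large s. *)
Lemma forced_ex (n : nat) (P : {set {set 'I_n}} -> {set {set 'I_n}} -> bool) :
  exists s, forced P s.
Proof.
exists #|{set 'I_n}|; apply/forallP => R; apply/forallP => B.
apply/implyP => _; apply/implyP => lt_s.
have := leq_trans lt_s (leq_trans (geq_minl _ _) (max_card (mem R))).
by rewrite ltnn.
Qed.

Definition threshold (n : nat)
    (P : {set {set 'I_n}} -> {set {set 'I_n}} -> bool) : nat :=
  ex_minn (forced_ex P).

(* Meaningful for 0 < r <= (esize G)./2. *)
Definition balr (r n : nat) (G : sgraph) : nat :=
  threshold (fun R B : {set {set 'I_n}} =>
    has_colored_copy G R B r (esize G - r) ||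
    has_colored_copy G R B (esize G - r) r).

Definition bal (n : nat) (G : sgraph) : nat :=
  threshold (fun R B : {set {set 'I_n}} =>
    has_colored_copy G R B (uphalf (esize G)) (esize G)./2 ||
    has_colored_copy G R B (esize G)./2 (uphalf (esize G))).

Definition ot (n : nat) (G : sgraph) : nat :=
  threshold (fun R B : {set {set 'I_n}} =>
    [forall r : 'I_(esize G).+1, forall b : 'I_(esize G).+1,
      (r + b == esize G) ==> has_colored_copy G R B r b]).

Definition nonvacuous (t : nat -> nat) : Prop :=
  exists n0 : nat, forall n : nat, n0 <= n -> t n < 'C(n, 2)./2.

Definition tonal (r : nat) (G : sgraph) : Prop := nonvacuous (fun n => balr r n G).
Definition balanceable (G : sgraph) : Prop := nonvacuous (fun n => bal n G).
Definition omnitonal (G : sgraph) : Prop := nonvacuous (fun n => ot n G).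

(* Main.v *)
Require Import Defs.
From mathcomp Require Import all_boot.
From mathcomp Require Import zify.

(* By Kovari-Sos-Turan, if both color classes have more than q^(2/q) n^(2-1/q)
   edges, each of them contains a K_{q,q}. Ramsey's theorem in the two sides of the
   red K_{q,q} gives a large red clique, or else two blue cliques joined by red
   edges; likewise with the colors exchanged. A red and a blue clique, after
   bipartite Ramsey between them, give a clique of one color with all other edges
   of the other color. So K_n contains one of two patterns, up to exchanging the
   colors: a clique of one color inside the other color, or a complete bipartite
   graph of one color between two cliques of the other.
   Conversely, for infinitely many n, K_n splits exactly in half according to each
   of these patterns (n a square for the bipartite one, a solution of a Pell
   equation for the clique one). If G is tonal, its copy in such an exact splitting
   gives a vertex partition of G, by which G embeds with the desired colors in any
   large enough pattern. *)

Set Implicit Arguments.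
Unset Strict Implicit.
Unset Printing Implicit Defensive.

(** * The Kovari-Sos-Turan theorem by double counting *)

Lemma rearrangement_expn (a b k : nat) :
  a * b ^ k + a ^ k * b <= a ^ k.+1 + b ^ k.+1.
Proof.
wlog le_ab : a b / a <= b => [H|].
  case: (leqP a b) => [/H //|/ltnW /H]; lia.
have le_abk : a ^ k <= b ^ k by case: k => // k; rewrite leq_exp2r.
rewrite !expnS; nia.
Qed.

(** Chebyshev's sum inequality: [rearrangement_expn] summed over all ordered pairs of indices. *)
Lemma sum_mul_sum_expn (T : finType) (d : T -> nat) (k : nat) :
  (\sum_i d i) * (\sum_i d i ^ k) <= #|T| * \sum_i d i ^ k.+1.
Proof.
rewrite -(leq_pmul2l (isT : 0 < 2)) !mul2n -!addnn.
have -> : #|T| * (\sum_i d i ^ k.+1) = \sum_(i : T) \sum_j d j ^ k.+1.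
  by rewrite sum_nat_const.
rewrite [X in _ + X]mulnC !big_distrlr [X in _ <= X + _]exchange_big -!big_split /=.
apply: leq_sum => i _; rewrite -!big_split /=; apply: leq_sum => j _.
exact: rearrangement_expn.
Qed.

(** The power mean inequality, by induction on [k] with one use of Chebyshev's inequality per
    step. *)
Lemma expn_sum_le (T : finType) (d : T -> nat) (k : nat) :
  (\sum_i d i) ^ k.+1 <= #|T| ^ k * \sum_i d i ^ k.+1.
Proof.
elim: k => [|k IHk]; first by rewrite mul1n expn1.
rewrite expnS (leq_trans (leq_mul (leqnn _) IHk)) //.
by rewrite mulnCA expnSr -mulnA leq_mul2l sum_mul_sum_expn orbT.
Qed.

Lemma ffact_le_expn (n q : nat) : n ^_ q <= n ^ q.
Proof.
by elim: q => // q IHq; rewrite ffactnSr expnSr leq_mul ?leq_subr.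
Qed.

(** A non-injective word of length [q.+1] repeats a letter at one of ['C(q.+1, 2)] pairs of
    positions, which leaves at most [n ^ q] choices for each pair. *)
Lemma expn_le_ffact (n q : nat) : n ^ q.+1 <= n ^_ q.+1 + 'C(q.+1, 2) * n ^ q.
Proof.
elim: q => [|q IHq]; first by rewrite ffactn1 expn1 leq_addr.
rewrite expnS (leq_trans (leq_mul (leqnn n) IHq)) //.
rewrite [n ^_ q.+2]ffactnSr ['C(q.+2, 2)]binS bin1.
have le_f := ffact_le_expn n q.+1.
rewrite !expnS in le_f *.
have := leq_mul (leqnn q.+1) le_f.
set F := n ^_ _; set P := n ^ q; set c := 'C(_, _).
have : n * F <= F * (n - q.+1) + q.+1 * F by nia.
nia.
Qed.

Definition mono_biclique (T : finType) (e : rel T) (c : bool) (X Y : {set T}) :=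
  {in X & Y, forall x y, e x y = c}.

(** With n = [#|T|], the hypothesis bounds the degree sum below by (q+1)^(2/(q+1)) n^(2-1/(q+1)),
    raised to the power q+1 to stay within natural numbers. *)
Lemma kovari_sos_turan (T : finType) (e : rel T) (q : nat) :
  q.+1 ^ 2 * #|T| ^ (q + q.+1) < (\sum_x #|e x|) ^ q.+1 ->
  exists X Y : {set T}, [/\ q < #|X|, q < #|Y| & mono_biclique e true X Y].
Proof.
move=> lt_e.
(* Double counting of pairs of a vertex and a (q+1)-tuple of its neighbors; the
   non-injective tuples are few enough to be bounded trivially. *)
pose common (f : {ffun 'I_q.+1 -> T}) := [set x | [forall i, e x (f i)]].
case: (boolP [exists f : {ffun 'I_q.+1 -> T},
    injectiveb f && (q < #|common f|)]) => [|noK].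
  case/existsP => f /andP[/injectiveP inj_f lt_q].
  exists (common f), [set f i | i : 'I_q.+1]; split=> //.
    by rewrite card_imset // card_ord.
  by move=> x y; rewrite inE => /forallP e_x /imsetP[i _ ->]; apply: e_x.
have count : \sum_x #|e x| ^ q.+1 = \sum_f #|common f|.
  transitivity (\sum_x \sum_(f : {ffun 'I_q.+1 -> T} | x \in common f) 1).
    apply: eq_bigr => x _; rewrite sum1_card -[in LHS](card_ord q.+1).
    rewrite -card_ffun_on; apply: eq_card => f.
    by rewrite -[RHS]/(x \in common f) [RHS]inE; apply/ffun_onP/forallP.
  rewrite (exchange_big_dep xpredT) //=.
  by apply: eq_bigr => f _; rewrite sum1_card; apply: eq_card.
have : \sum_f #|common f| <= q.+1 ^ 2 * #|T| ^ q.+1.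
  have card_inj : #|[pred f : {ffun 'I_q.+1 -> T} | injectiveb f]| = #|T| ^_ q.+1.
    by rewrite -[in RHS](card_ord q.+1) -card_inj_ffuns; apply: eq_card => f; rewrite inE.
  rewrite (bigID (fun f : {ffun 'I_q.+1 -> T} => injectiveb f)) /=.
  have le1 : \sum_(f : {ffun 'I_q.+1 -> T} | injectiveb f) #|common f|
              <= #|T| ^_ q.+1 * q.
    rewrite -card_inj -sum_nat_const; apply: leq_sum => f inj_f.
    move/existsPn: noK => /(_ f); rewrite inj_f /= -leqNgt //.
  have le2 : \sum_(f : {ffun 'I_q.+1 -> T} | ~~ injectiveb f) #|common f|
              <= (#|T| ^ q.+1 - #|T| ^_ q.+1) * #|T|.
    rewrite -card_inj -[X in _ ^ X](card_ord q.+1) -card_ffun.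
    rewrite -(cardC [pred f : {ffun 'I_q.+1 -> T} | injectiveb f]) addKn.
    by rewrite -sum_nat_const; apply: leq_sum => f _; apply: max_card.
  (* The two parts add up to at most (q + q(q+1)/2) n^(q+1), whence the constant [q.+1 ^ 2]. *)
  have := expn_le_ffact #|T| q; have := bin2 q.+1.
  have := ffact_le_expn #|T| q.+1.
  move: le1 le2; rewrite !expnS /=; set c := 'C(_, _); nia.
rewrite -count leqNgt => /negP[].
have := leq_trans lt_e (expn_sum_le _ _).
by rewrite expnD mulnCA ltn_mul2l => /andP[].
Qed.

(** * Ramsey theorems for cliques and bicliques *)

Definition mono_clique (T : finType) (e : rel T) (c : bool) (S : {set T}) :=
  {in S &, forall x y, x != y -> e x y = c}.

Lemma ramsey (T : finType) (e : rel T) (a b : nat) (A : {set T}) :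
  symmetric e -> 2 ^ (a + b) <= #|A| ->
  exists2 S : {set T}, S \subset A &
    a <= #|S| /\ mono_clique e true S \/ b <= #|S| /\ mono_clique e false S.
Proof.
move=> sym_e; have [m] := ubnP (a + b); elim: m => // m IHm in a b A *.
rewrite ltnS => le_m leA.
have mono0 c : mono_clique e c set0 by move=> x y; rewrite inE.
case: a le_m leA => [|a] le_m leA.
  by exists set0; rewrite ?sub0set //; left.
case: b le_m leA => [|b] le_m leA.
  by exists set0; rewrite ?sub0set //; right.
have /card_gt0P[v vA] : 0 < #|A| by rewrite (leq_trans _ leA) ?expn_gt0.
pose N (c : bool) : {set T} := [set y in A :\ v | e v y == c].
have sub_N c : N c \subset A :\ v by apply/subsetP => y; rewrite inE => /andP[].
have sum_N : #|A| = (#|N true| + #|N false|).+1.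
  rewrite (cardsD1 v) vA add1n -(cardsID (N true) (A :\ v)).
  congr (_ + _).+1; apply: eq_card => y; rewrite !inE.
    by case: (y != v) (y \in A) (e v y) => [] [] [].
  by case: (y != v) (y \in A) (e v y) => [] [] [].
have extend c (S : {set T}) k : S \subset N c -> k <= #|S| -> mono_clique e c S ->
    [/\ v |: S \subset A, k.+1 <= #|v |: S| & mono_clique e c (v |: S)].
  move=> sSN leS monoS; have sSA := subset_trans sSN (sub_N c).
  have vS : v \notin S.
    by apply/negP => /(subsetP sSA); rewrite !inE eqxx.
  split.
  - rewrite subUset sub1set vA; exact: subset_trans sSA (subsetDl _ _).
  - by rewrite cardsU1 vS.
  have ev y : y \in S -> e v y = c.
    by move/(subsetP sSN); rewrite inE => /andP[_ /eqP].
  move=> x y /setU1P[->|xS] /setU1P[->|yS]; rewrite ?eqxx //.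
  - by move=> _; apply: ev.
  - by move=> _; rewrite sym_e; apply: ev.
  - exact: monoS.
have sub_NA c : N c \subset A := subset_trans (sub_N c) (subsetDl _ _).
have [leT|ltT] := leqP (2 ^ (a + b.+1)) #|N true|.
  have [|S sSN [[leS monoS]|[leS monoS]]] := IHm a b.+1 (N true) _ leT; first by lia.
    by have [] := extend _ _ _ sSN leS monoS; exists (v |: S); last left.
  by exists S; [exact: subset_trans sSN _|right].
(* The vertex [v] lost from [A] is made up for by the strict inequality in [ltT]. *)
have leF : 2 ^ (a.+1 + b) <= #|N false|.
  by move: leA ltT; rewrite sum_N !addSn !addnS !expnS; lia.
have [|S sSN [[leS monoS]|[leS monoS]]] := IHm a.+1 b (N false) _ leF; first by lia.
  by exists S; [exact: subset_trans sSN _|left].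
by have [] := extend _ _ _ sSN leS monoS; exists (v |: S); last right.
Qed.

(** Pigeonhole on the at most [2 ^ #|A|] neighborhoods in [A]: at least [t] vertices of [B] share
    one neighborhood [P], and [P] or its complement contains [t] vertices of [A]. *)
Lemma bipartite_ramsey (T : finType) (e : rel T) (t : nat) (A B : {set T}) :
  t.*2 <= #|A| -> t * 2 ^ #|A| < #|B| ->
  exists c, exists A' B' : {set T}, [/\ A' \subset A, B' \subset B,
    t <= #|A'|, t <= #|B'| & mono_biclique e c A' B'].
Proof.
move=> leA ltB.
pose N y := [set x in A | e x y].
have [P leP] : exists P : {set T}, t <= #|[set y in B | N y == P]|.
  apply/existsP; apply: contraLR ltB => /existsPn noP.
  rewrite -leqNgt -card_powerset mulnC -sum_nat_const.
  rewrite -sum1_card (partition_big N (mem (powerset A))) /=.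
    apply: leq_sum => P _; have := noP P; rewrite -ltnNge => /ltnW.
    by apply: leq_trans; rewrite sum1_card subset_leq_card //;
       apply/subsetP => y; rewrite !inE.
  by move=> y _; rewrite inE; apply/subsetP => x; rewrite inE => /andP[].
set B' := [set y in B | _] in leP.
have sB : B' \subset B by apply/subsetP => y; rewrite inE => /andP[].
have NB' x y : x \in A -> y \in B' -> e x y = (x \in P).
  by move=> xA; rewrite !inE => /andP[_ /eqP <-]; rewrite inE xA.
have := cardsID P A; case: (leqP t #|A :&: P|) => [leAP _|ltAP sumA].
  exists true, (A :&: P), B'; split=> //; first exact: subsetIl.
  by move=> x y /setIP[xA xP] /(NB' x y xA) ->.
exists false, (A :\: P), B'; split=> //; first exact: subsetDl.
  by lia.
by move=> x y /setDP[xA xP] /(NB' x y xA) ->; apply/negbTE.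
Qed.

(** * Unavoidable patterns in two-colorings *)

Definition adj (T : finType) (R : {set {set T}}) : rel T :=
  fun x y => [set x; y] \in R.

Lemma adj_sym (T : finType) (R : {set {set T}}) : symmetric (adj R).
Proof. by move=> x y; rewrite /adj setUC. Qed.

Lemma adj_irr (T : finType) (R : {set {set T}}) (x : T) :
  R \subset complete_edges T -> adj R x x = false.
Proof.
move/subsetP => sR; apply/negP => /sR.
by rewrite inE setUid cards1.
Qed.

Lemma card_le_sum_adj (T : finType) (R : {set {set T}}) :
  R \subset complete_edges T -> #|R| <= \sum_x #|adj R x|.
Proof.
move/subsetP => sR.
under eq_bigr => x _ do rewrite -sum1_card.
rewrite pair_big_dep /= sum1_card.
apply: leq_trans (leq_imset_card (fun p : T * T => [set p.1; p.2]) _).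
apply: subset_leq_card; apply/subsetP => e eR.
have /[1!inE] /cards2P[x [y [_ def_e]]] := sR _ eR.
by apply/imsetP; exists (x, y) => //; rewrite -topredE /= /adj -def_e.
Qed.

(** Here [2 ^ (s + s)] is the Ramsey bound for [s] against [s], applied to each side of the
    biclique. The sides are disjoint because a common vertex would carry a loop. *)
Lemma clique_or_split (T : finType) (R : {set {set T}}) (s : nat) :
  R \subset complete_edges T ->
  (2 ^ (s + s)).+1 ^ 2 * #|T| ^ (2 ^ (s + s) + (2 ^ (s + s)).+1)
    < #|R| ^ (2 ^ (s + s)).+1 ->
  (exists2 S : {set T}, s <= #|S| & mono_clique (adj R) true S) \/
  exists X Y : {set T}, [/\ s <= #|X|, s <= #|Y|, [disjoint X & Y],
    mono_clique (adj R) false X /\ mono_clique (adj R) false Y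
    & mono_biclique (adj R) true X Y].
Proof.
move=> sR ltR.
have [|X [Y [leX leY biXY]]] := @kovari_sos_turan T (adj R) (2 ^ (s + s)).
  by rewrite (leq_trans ltR) // leq_exp2r // card_le_sum_adj.
have [X' sX [[leX' mX]|[leX' mX]]] := ramsey (adj_sym R) (ltnW leX).
  by left; exists X'.
have [Y' sY [[leY' mY]|[leY' mY]]] := ramsey (adj_sym R) (ltnW leY).
  by left; exists Y'.
right; exists X', Y'; split=> //; last first.
  by move=> x y /(subsetP sX) xX /(subsetP sY); apply: biXY.
rewrite -setI_eq0; apply/eqP/setP => x; rewrite !inE; apply/negP.
case/andP => /(subsetP sX) xX /(subsetP sY) xY.
by have := biXY _ _ xX xY; rewrite adj_irr.
Qed.

(* With [sigma = false], [j = 2] is a red clique on [S1] with all other edges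
   blue, and [j = 1] is a red complete bipartite graph between [S1] and [S2]
   with two blue cliques; [sigma = true] exchanges the colors. *)
Definition patterned (T : finType) (R : {set {set T}}) (j : nat) (sigma : bool)
    (S1 S2 : {set T}) : Prop :=
  [disjoint S1 & S2] /\
  forall e : {set T}, #|e| = 2 -> e \subset S1 :|: S2 ->
    (e \in R) = (#|e :&: S1| == j) (+) sigma.

Lemma card_pairI (T : finType) (x y : T) (S : {set T}) :
  x != y -> #|[set x; y] :&: S| = (x \in S) + (y \in S).
Proof.
move=> ne_xy; rewrite setIUl cardsU.
have -> : [set x] :&: S :&: ([set y] :&: S) = set0.
  apply/setP => z; rewrite !inE; apply/negP.
  by case/andP => /andP[/eqP-> _] /andP[/eqP xy]; rewrite xy eqxx in ne_xy.
have card1I z : #|[set z] :&: S| = (z \in S).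
  case: (boolP (z \in S)) => zS; first by rewrite (setIidPl _) ?sub1set ?cards1.
  by apply/eqP; rewrite cards_eq0 setI_eq0 disjoints1.
by rewrite cards0 subn0 !card1I.
Qed.

Lemma patterned_mono (T : finType) (R : {set {set T}}) (j : nat) (sigma : bool)
    (S1 S2 : {set T}) :
  [disjoint S1 & S2] ->
  mono_clique (adj R) ((2 == j) (+) sigma) S1 ->
  mono_clique (adj R) ((0 == j) (+) sigma) S2 ->
  mono_biclique (adj R) ((1 == j) (+) sigma) S1 S2 ->
  patterned R j sigma S1 S2.
Proof.
move=> dis m1 m2 m12; split=> // e /eqP/cards2P[x [y [ne_xy ->]]].
rewrite subUset !sub1set card_pairI // -[_ \in R]/(adj R x y) => /andP[].
have notS1 z : z \in S2 -> z \in S1 = false.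
  by move=> zS2; apply/negP => /(disjointFr dis); rewrite zS2.
case/setUP => [x1|x2] /setUP[y1|y2].
- by rewrite x1 y1 m1.
- by rewrite x1 notS1 // m12.
- by rewrite y1 notS1 // adj_sym m12.
- by rewrite !notS1 // m2.
Qed.

Lemma exists_subset_card (T : finType) (A : {set T}) (k : nat) :
  k <= #|A| -> exists2 S : {set T}, S \subset A & #|S| = k.
Proof.
rewrite -bin_gt0 -cards_draws => /card_gt0P[S].
by rewrite inE => /andP[sSA /eqP]; exists S.
Qed.

Lemma unavoidable_pattern (t : nat) : exists q : nat,
  forall (T : finType) (R : {set {set T}}), R \subset complete_edges T ->
  q.+1 ^ 2 * #|T| ^ (q + q.+1) < #|R| ^ q.+1 ->
  q.+1 ^ 2 * #|T| ^ (q + q.+1) < #|complete_edges T :\: R| ^ q.+1 ->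
  exists j sigma (S1 S2 : {set T}),
    [/\ (j == 1) || (j == 2), t <= #|S1|, t <= #|S2| & patterned R j sigma S1 S2].
Proof.
(* Room for [t.*2] vertices of a red clique, and for more than [t * 2 ^ t.*2] vertices of a blue
   clique after removal of the at most one vertex that the two cliques share. *)
pose s := (t * 2 ^ t.*2).+2 + t.*2.
exists (2 ^ (s + s)) => T R sR ltR ltB.
have sB : complete_edges T :\: R \subset complete_edges T := subsetDl _ _.
have adjB x y : x != y -> adj (complete_edges T :\: R) x y = ~~ adj R x y.
  by move=> ne_xy; rewrite /adj in_setD inE cards2 ne_xy andbT.
have monoB c S : mono_clique (adj (complete_edges T :\: R)) c S ->
    mono_clique (adj R) (~~ c) S.
  by move=> mS x y xS yS ne; rewrite -(mS x y xS yS ne) adjB // negbK.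
have le_ts : t <= s by rewrite /s; lia.
case: (clique_or_split sR ltR) => [[A leA mA]|]; last first.
  case=> X [Y [leX leY dis [mX mY] mXY]].
  exists 1, false, X, Y; split; rewrite ?(leq_trans le_ts) //.
  exact: patterned_mono.
case: (clique_or_split sB ltB) => [[B leB /monoB mB]|]; last first.
  case=> X [Y [leX leY dis [/monoB mX /monoB mY] mXY]].
  exists 1, true, X, Y; split; rewrite ?(leq_trans le_ts) //.
  apply: patterned_mono => // x y xX yY; have := mXY x y xX yY.
  rewrite adjB; first by move/negbTE.
  by apply: contraTneq xX => ->; rewrite (disjointFl dis).
have [|A' sA cardA] := @exists_subset_card _ A t.*2; first by rewrite /s in leA; lia.
have le1 : #|B :&: A'| <= 1.
  apply/card_le1_eqP => x y /setIP[xB /(subsetP sA) xA] /setIP[yB /(subsetP sA) yA].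
  by apply/eqP; apply/negPn/negP => ne; have := mB y x yB xB ne; rewrite mA.
have [||c [A2 [B2 [sA2 sB2 leA2 leB2 mAB]]]] :=
    @bipartite_ramsey _ (adj R) t A' (B :\: A').
- by rewrite cardA.
- have := cardsID A' B; rewrite cardA; move: leB; rewrite /s; lia.
have sA2A := subset_trans sA2 sA.
have sB2B := subset_trans sB2 (subsetDl _ _).
have mA2 : mono_clique (adj R) true A2.
  by move=> x y /(subsetP sA2A) xA /(subsetP sA2A); apply: mA.
have mB2 : mono_clique (adj R) false B2.
  by move=> x y /(subsetP sB2B) xB /(subsetP sB2B); apply: mB.
have dis : [disjoint A2 & B2].
  rewrite disjoints_subset; apply/subsetP => x /(subsetP sA2) xA.
  by rewrite inE; apply: contraL xA => /(subsetP sB2) /setDP[].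
(* The clique whose color differs from that of the biclique becomes [S1]; the other one merges with
   the biclique into the surrounding color. *)
case: c mAB => mAB.
  exists 2, true, B2, A2; split=> //; apply: patterned_mono => //.
    by rewrite disjoint_sym.
  by move=> x y xB yA; rewrite adj_sym; apply: mAB.
by exists 2, false, A2, B2; split=> //; apply: patterned_mono.
Qed.

(** * Cuts of a graph and its colored copies in patterns *)

(** The edges that become red when [X] is mapped into [S1] and its complement into [S2], in a
    pattern with [sigma = false]. *)
Definition cut (G : sgraph) (j : nat) (X : {set vertex G}) : {set {set vertex G}} :=
  [set e in edges G | #|e :&: X| == j].

Lemma edge_card (G : sgraph) (e : {set vertex G}) : e \in edges G -> #|e| = 2.
Proof. by move/(subsetP (@edgesP G)); rewrite inE => /eqP. Qed.

Lemma card_copy_edgesI (G : sgraph) (n : nat) (f : {ffun vertex G -> 'I_n})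
    (C : {set {set 'I_n}}) :
  injective f ->
  #|copy_edges f :&: C| = #|[set e in edges G | f @: (e : {set vertex G}) \in C]|.
Proof.
move=> inj_f; rewrite -(card_imset _ (imset_inj inj_f)); apply: eq_card => E.
rewrite inE; apply/andP/imsetP => [[/imsetP[e eG ->] eC]|[e + ->]].
  by exists e; rewrite // inE eG.
by rewrite inE => /andP[eG eC]; split=> //; apply: imset_f.
Qed.

Lemma imset_preimI (aT rT : finType) (f : aT -> rT) (A : {set aT}) (S : {set rT}) :
  f @: A :&: S = f @: (A :&: f @^-1: S).
Proof.
apply/setP => y; rewrite inE; apply/andP/imsetP => [[/imsetP[x xA ->] xS]|[x + ->]].
  by exists x; rewrite // !inE xA.
by rewrite !inE => /andP[xA xS]; split=> //; apply: imset_f.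
Qed.

Lemma card_cutC (G : sgraph) (j : nat) (X : {set vertex G}) :
  #|[set e in edges G | ~~ (#|e :&: X| == j)]| = esize G - #|cut j X|.
Proof.
rewrite /esize -(cardsID (cut j X) (edges G)) /cut.
have -> : edges G :&: [set e in edges G | #|e :&: X| == j]
          = [set e in edges G | #|e :&: X| == j].
  by apply/setP => e; rewrite !inE andbA andbb.
rewrite addKn; apply: eq_card => e; rewrite !inE.
by case: (e \in edges G); rewrite ?andbF ?andbT.
Qed.

(** In a pattern the color of an edge depends only on how many of its ends lie in [S1], so any
    injection taking [X] into [S1] and the rest into [S2] works. Both sides have room for all of
    [G], whatever [X] is. *)
Lemma colored_copy_patterned (G : sgraph) (n j : nat) (sigma : bool)
    (R B : {set {set 'I_n}}) (S1 S2 : {set 'I_n}) (X : {set vertex G}) :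
  two_coloring R B -> patterned R j sigma S1 S2 ->
  #|vertex G| <= #|S1| -> #|vertex G| <= #|S2| ->
  has_colored_copy G R B (if sigma then esize G - #|cut j X| else #|cut j X|)
                         (if sigma then #|cut j X| else esize G - #|cut j X|).
Proof.
case/andP => /eqP def_RB disRB [dis patR] le1 le2.
pose emb S (le : #|vertex G| <= #|S|) (x : vertex G) : 'I_n :=
  enum_val (widen_ord le (enum_rank x)).
have embS S le x : @emb S le x \in S by apply: enum_valP.
have inj_emb S le : injective (@emb S le).
  by move=> x y /enum_val_inj /(congr1 val) /= /val_inj /enum_rank_inj.
pose f : {ffun vertex G -> 'I_n} :=
  [ffun x => if x \in X then emb S1 le1 x else emb S2 le2 x].
have fS1 x : (f x \in S1) = (x \in X).
  rewrite ffunE; case: ifP => _; first exact: embS.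
  by apply/negP => /(disjointFr dis); rewrite embS.
have inj_f : injective f.
  move=> x y eq_f; have := fS1 x; rewrite eq_f fS1 => eqX.
  by move: eq_f; rewrite !ffunE eqX; case: ifP => _; apply: inj_emb.
have preimX : f @^-1: S1 = X by apply/setP => x; rewrite inE fS1.
have card_f e : e \in edges G -> #|f @: (e : {set vertex G})| = 2.
  by move/edge_card <-; rewrite card_imset.
have in_R e : e \in edges G -> (f @: (e : {set vertex G}) \in R)
    = (#|e :&: X| == j) (+) sigma.
  move=> eG; rewrite patR ?card_f //.
    by rewrite imset_preimI preimX card_imset.
  apply/subsetP => _ /imsetP[x _ ->]; rewrite inE fS1.
  by case: (boolP (x \in X)) => //= xX; rewrite ffunE (negbTE xX).
have in_B e : e \in edges G -> (f @: (e : {set vertex G}) \in B)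
    = ~~ ((#|e :&: X| == j) (+) sigma).
  move=> eG; rewrite -in_R //; have : f @: (e : {set vertex G}) \in R :|: B.
    by rewrite def_RB inE card_f.
  rewrite inE => /orP[inR|inB]; first by rewrite inR (disjointFr disRB).
  by rewrite inB (disjointFl disRB).
apply/existsP; exists f; rewrite !card_copy_edgesI //.
have -> : [set e in edges G | f @: (e : {set vertex G}) \in R]
    = [set e in edges G | (#|e :&: X| == j) (+) sigma].
  by apply/setP => e; rewrite !inE; case: (boolP (e \in edges G)) => // /in_R ->.
have -> : [set e in edges G | f @: (e : {set vertex G}) \in B]
    = [set e in edges G | ~~ ((#|e :&: X| == j) (+) sigma)].
  by apply/setP => e; rewrite !inE; case: (boolP (e \in edges G)) => // /in_B ->.
apply/and3P; split; first exact/injectiveP; case: sigma {patR in_R in_B} => /=;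
  rewrite -?card_cutC; apply/eqP; apply: eq_card => e; rewrite !inE;
  by rewrite ?addbT ?addbF ?negbK.
Qed.

(** The preimage of [S] under the embedding is the required vertex set. *)
Lemma cut_of_colored_copy (G : sgraph) (n j r b : nat) (S : {set 'I_n})
    (B : {set {set 'I_n}}) :
  has_colored_copy G [set e in complete_edges 'I_n | #|e :&: S| == j] B r b ->
  exists X : {set vertex G}, #|cut j X| = r.
Proof.
case/existsP => f /and3P[/injectiveP inj_f /eqP <- _]; exists (f @^-1: S).
rewrite card_copy_edgesI //; apply: eq_card => e; rewrite !inE.
case: (boolP (e \in edges G)) => //= /edge_card card_e.
by rewrite card_imset // card_e eqxx imset_preimI card_imset.
Qed.

(** * Patterns splitting the complete graph exactly in half *)

Lemma mul2_bin2D (n : nat) : 2 * 'C(n, 2) + n = n * n.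
Proof. by elim: n => // n IHn; rewrite binS bin1; nia. Qed.

Lemma card_complete_edges (T : finType) : #|complete_edges T| = 'C(#|T|, 2).
Proof.
by rewrite -cardsT -cards_draws; apply: eq_card => e; rewrite !inE subsetT.
Qed.

(** The red class of the pattern [j] spread over all of [T], with [S] and its complement as the two
    sides. *)
Definition level (T : finType) (j : nat) (S : {set T}) : {set {set T}} :=
  [set e in complete_edges T | #|e :&: S| == j].

Lemma card_level2 (T : finType) (S : {set T}) : #|level 2 S| = 'C(#|S|, 2).
Proof.
rewrite -cards_draws; apply: eq_card => e; rewrite !inE andbC.
case: (boolP (#|e| == 2)) => [/eqP card_e|_]; rewrite ?andbF ?andbT //.
apply/eqP/idP => [card_eS|/setIidPl -> //].
by apply/setIidPl/eqP; rewrite eqEcard subsetIl card_e card_eS.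
Qed.

Lemma card_level1 (T : finType) (S : {set T}) :
  #|level 1 S| + 'C(#|S|, 2) + 'C(#|~: S|, 2) = 'C(#|T|, 2).
Proof.
have cardI e : #|e :&: S| + #|e :&: ~: S| = #|e| by rewrite -setDE cardsID.
rewrite -card_complete_edges -!card_level2 -(cardsID (level 1 S) (complete_edges T)) -addnA.
congr (_ + _).
  apply: eq_card => e; rewrite !inE.
  by case: (#|e| == 2); rewrite ?andbF ?andbT.
rewrite -(cardsID (level 2 S) (_ :\: _)); congr (_ + _); apply: eq_card => e;
  rewrite !inE; have := cardI e; case: (#|e| =P 2) => [->|]; rewrite ?andbF //=;
  by case: (#|e :&: S|) => [|[|[|m]]] //=; lia.
Qed.

Lemma half_split_clique (N : nat) :
  exists n k, [/\ N <= n, k <= n & 2 * 'C(k, 2) = 'C(n, 2)].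
Proof.
(* The solutions of the negative Pell equation (2n-1)^2 - 2(2k-1)^2 = -1. *)
suff [n [k [leN le_kn eq_nk]]] :
    exists n k, [/\ N <= n, k <= n & 2 * (k.+1 * k) = n.+1 * n].
  exists n.+1, k.+1; split; [lia|lia|].
  by have := mul2_bin2D n.+1; have := mul2_bin2D k.+1; lia.
elim: N => [|N [n [k [leN le_kn eq_nk]]]]; first by exists 0, 0.
(* In terms of x = 2n+1 and y = 2k+1, this multiplies x + y sqrt 2 by the unit 3 + 2 sqrt 2; the
   start [0, 0] is x = y = 1. *)
by exists (3 * n + 4 * k + 3), (2 * n + 3 * k + 2); split; lia.
Qed.

(** The equation amounts to (a-b)^2 = a+b, solved by consecutive triangular numbers: their
    difference is N+1 and their sum (N+1)^2. *)
Lemma half_split_bipartite (N : nat) :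
  exists a b, N <= a + b /\ 'C(a + b, 2) = 2 * ('C(a, 2) + 'C(b, 2)).
Proof.
exists 'C(N.+1, 2), 'C(N.+2, 2).
have [a2 b2] := (mul2_bin2D N.+1, mul2_bin2D N.+2).
set a := 'C(N.+1, 2) in a2 *; set b := 'C(N.+2, 2) in b2 *.
have -> : b = a + N.+1 by lia.
have := mul2_bin2D a; have := mul2_bin2D (a + N.+1).
have := mul2_bin2D (a + (a + N.+1)); split; first by lia.
nia.
Qed.

Lemma half_level (j N : nat) : (j == 1) || (j == 2) ->
  exists n (S : {set 'I_n}), N <= n /\ #|level j S| = 'C(n, 2)./2.
Proof.
have set_of_card n k : k <= n -> exists S : {set 'I_n}, #|S| = k.
  move=> le_kn; have [|S _] := @exists_subset_card 'I_n setT k; last by exists S.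
  by rewrite cardsT card_ord.
case/orP => /eqP->.
  have [a [b [leN half]]] := half_split_bipartite N.
  have [S cardS] := set_of_card (a + b) a (leq_addr b a).
  exists (a + b), S; split=> //; have := card_level1 S.
  have := cardsC S; rewrite card_ord cardS => /addnI ->; lia.
have [n [k [leN le_kn half]]] := half_split_clique N.
have [S cardS] := set_of_card n k le_kn.
by exists n, S; split=> //; rewrite card_level2 cardS; lia.
Qed.

(** * Polynomial bounds on the thresholds *)

Lemma two_coloringC (n : nat) (R : {set {set 'I_n}}) :
  R \subset complete_edges 'I_n -> two_coloring R (complete_edges 'I_n :\: R).
Proof.
move=> sR; apply/andP; split; first by rewrite -{1}(setIidPr sR) setID.
by rewrite disjoint_sym disjoints_subset setDE subsetIr.
Qed.

Lemma threshold_forced (n : nat)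
    (P : {set {set 'I_n}} -> {set {set 'I_n}} -> bool) (R B : {set {set 'I_n}}) :
  two_coloring R B -> threshold P < minn #|R| #|B| -> P R B.
Proof.
rewrite /threshold; case: ex_minnP => s /forallP/(_ R)/forallP/(_ B) forcedP _.
by move=> RB lt_s; move: forcedP; rewrite RB lt_s.
Qed.

(** Nonvacuity only puts the threshold below half of all edges, so an exactly halved coloring is
    what is certain to exceed it. *)
Lemma nonvacuous_level (P : forall n, {set {set 'I_n}} -> {set {set 'I_n}} -> bool)
    (j : nat) :
  nonvacuous (fun n => threshold (@P n)) -> (j == 1) || (j == 2) ->
  exists n (S : {set 'I_n}) (B : {set {set 'I_n}}), P n (level j S) B.
Proof.
case=> N ltP j12; have [n [S [leN cardS]]] := half_level N j12.
have sS : level j S \subset complete_edges 'I_n.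
  by apply/subsetP => e; rewrite inE => /andP[].
exists n, S, (complete_edges 'I_n :\: level j S).
apply: threshold_forced; first exact: two_coloringC.
rewrite cardsD (setIidPr sS) cardS card_complete_edges card_ord.
by have := ltP n leN; lia.
Qed.

(** By minimality: if a threshold [s.+1] broke the bound, each coloring with more than [s] edges of
    both colors would contain a pattern, so [s] would already be forced. *)
Lemma threshold_bound (t : nat) : exists q : nat,
  forall (n : nat) (P : {set {set 'I_n}} -> {set {set 'I_n}} -> bool),
  (forall (R B : {set {set 'I_n}}) j sigma (S1 S2 : {set 'I_n}),
     two_coloring R B -> (j == 1) || (j == 2) -> t <= #|S1| -> t <= #|S2| ->
     patterned R j sigma S1 S2 -> P R B) ->
  threshold P ^ q.+1 <= q.+1 ^ 2 * n ^ (q + q.+1).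
Proof.
have [q pat_q] := unavoidable_pattern t; exists q => n P patP.
rewrite /threshold; case: ex_minnP => -[|s] forced_s min_s; first by rewrite exp0n.
rewrite leqNgt; apply/negP => lt_q.
suff /min_s : forced P s by rewrite ltnn.
apply/forallP => R; apply/forallP => B; apply/implyP => RB; apply/implyP => lt_s.
have [/eqP def_RB dis] := andP RB.
have sR : R \subset complete_edges 'I_n by rewrite -def_RB subsetUl.
have defB : B = complete_edges 'I_n :\: R.
  by rewrite -def_RB setDUl setDv set0U; apply/esym/setDidPl; rewrite disjoint_sym.
have [||j [sigma [S1 [S2 [j12 le1 le2 pat]]]]] := pat_q _ R sR.
- by rewrite card_ord (leq_trans lt_q) // leq_exp2r // (leq_trans lt_s) ?geq_minl.
- by rewrite -defB card_ord (leq_trans lt_q) // leq_exp2r // (leq_trans lt_s) ?geq_minr.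
exact: patP RB j12 le1 le2 pat.
Qed.

(** The halved coloring yields a cut of size [r] or [esize G - r]. Either size suffices, since the
    conclusion is symmetric under exchange of the colors. *)
Lemma balr_copy (G : sgraph) (r : nat) : tonal r G -> r <= esize G ->
  forall n (R B : {set {set 'I_n}}) j sigma (S1 S2 : {set 'I_n}),
  two_coloring R B -> (j == 1) || (j == 2) ->
  #|vertex G| <= #|S1| -> #|vertex G| <= #|S2| -> patterned R j sigma S1 S2 ->
  has_colored_copy G R B r (esize G - r) || has_colored_copy G R B (esize G - r) r.
Proof.
move=> tonal_r le_r n R B j sigma S1 S2 RB j12 le1 le2 pat.
have [n' [S [B']]] := nonvacuous_level tonal_r j12.
case/orP => /cut_of_colored_copy [X cardX];
  have := colored_copy_patterned X RB pat le1 le2; rewrite cardX ?subKn //;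
  by case: sigma {pat} => ->; rewrite ?orbT.
Qed.

Lemma ot_copy (G : sgraph) : omnitonal G ->
  forall n (R B : {set {set 'I_n}}) j sigma (S1 S2 : {set 'I_n}),
  two_coloring R B -> (j == 1) || (j == 2) ->
  #|vertex G| <= #|S1| -> #|vertex G| <= #|S2| -> patterned R j sigma S1 S2 ->
  [forall r : 'I_(esize G).+1, forall b : 'I_(esize G).+1,
      (r + b == esize G) ==> has_colored_copy G R B r b].
Proof.
move=> omni n R B j sigma S1 S2 RB j12 le1 le2 pat.
have [n' [S [B' /forallP allP]]] := nonvacuous_level omni j12.
apply/forallP => r; apply/forallP => b; apply/implyP => /eqP sum_rb.
(* With exchanged colors the cut edges turn blue, so the cut must then have size [b]. *)
pose c := if sigma then b else r; pose c' := if sigma then r else b.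
have /cut_of_colored_copy[X cardX] : has_colored_copy G (level j S) B' c c'.
  apply: (implyP (forallP (allP c) c')).
  by rewrite /c /c'; case: (sigma); rewrite ?[b + r]addnC sum_rb.
have [def_r def_b] : esize G - b = r /\ esize G - r = b by lia.
have := colored_copy_patterned X RB pat le1 le2; rewrite cardX /c.
by case: (sigma); rewrite ?def_r ?def_b.
Qed.

Lemma bal_half (n : nat) (G : sgraph) : bal n G = balr (esize G)./2 n G.
Proof.
rewrite /bal /balr /threshold; apply: eq_ex_minn => s.
apply: eq_forallb => R; apply: eq_forallb => B.
have -> : esize G - (esize G)./2 = uphalf (esize G).
  by have := uphalfK (esize G); have := halfK (esize G); lia.
by rewrite orbC.
Qed.

(* Real exponents and asymptotics *)
From mathcomp Require Import all_boot all_order all_algebra.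
From mathcomp Require Import all_classical all_reals all_analysis.
From mathcomp Require Import ring.
Import Order.TTheory GRing.Theory Num.Theory.
Import numFieldNormedType.Exports.
Local Open Scope classical_set_scope.
Local Open Scope ring_scope.

(** Taking (q+1)-th roots gives the exponent (2q+1)/(q+1) = 2 - 1/(q+1) and the constant
    (q+1)^(2/(q+1)). *)
Lemma bigO_of_expn_bound (R : realType) (t : nat -> nat) (q : nat) :
  (forall n, (t n ^ q.+1 <= q.+1 ^ 2 * n ^ (q + q.+1))%N) ->
  (fun n : nat => (t n)%:R : R) =O_\oo
  (fun n : nat => n%:R `^ (2 - q.+1%:R^-1) : R).
Proof.
move=> le_t; set m : R := q.+1%:R.
have m0 : m != 0 by rewrite pnatr_eq0.
apply/eqO_exP; exists ((m ^+ 2) `^ m^-1).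
  by rewrite powR_gt0 // exprn_gt0 // ltr0n.
near=> n; rewrite ger0_norm ?ler0n // ger0_norm ?powR_ge0 //.
have -> : 2 - m^-1 = (q + q.+1)%:R * m^-1.
  have -> : (q + q.+1)%:R = 2 * m - 1 :> R.
    by rewrite natrD /m -natr1; ring.
  by rewrite mulrBl mulfK // mul1r.
rewrite powRrM !powR_mulrn ?ler0n // -powRM ?exprn_ge0 ?ler0n //.
have -> : (t n)%:R = ((t n)%:R ^+ q.+1) `^ m^-1 :> R.
  by rewrite -powR_mulrn ?ler0n // -powRrM mulfV // powRr1 ?ler0n.
rewrite ge0_ler_powR ?nnegrE ?invr_ge0 ?ler0n ?mulr_ge0 ?exprn_ge0 //.
by rewrite -!natrX -natrM ler_nat.
Unshelve. all: by end_near. Qed.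

Theorem corollary2p7 (R : realType) (G : sgraph) :
  (exists m : nat, (0 < m)%N /\
     (forall r : nat, (0 < r)%N -> (r <= (esize G)./2)%N -> tonal r G ->
        (fun n : nat => (balr r n G)%:R : R) =O_\oo
        (fun n : nat => n%:R `^ (2 - m%:R^-1) : R)) /\
     (balanceable G ->
        (fun n : nat => (bal n G)%:R : R) =O_\oo
        (fun n : nat => n%:R `^ (2 - m%:R^-1) : R))) /\
  (omnitonal G ->
   exists m : nat, (0 < m)%N /\
     (fun n : nat => (ot n G)%:R : R) =O_\oo
     (fun n : nat => n%:R `^ (2 - m%:R^-1) : R)).
Proof.
(* The exponent is fixed by the number of vertices alone, before [r] is chosen, so one [m] serves
   all [r]. *)
have [q bound_q] := threshold_bound #|vertex G|.
have bigO_balr r : (r <= (esize G)./2)%N -> tonal r G ->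
    (fun n : nat => (balr r n G)%:R : R) =O_\oo
    (fun n : nat => n%:R `^ (2 - q.+1%:R^-1) : R).
  move=> le_r tonal_r; apply: bigO_of_expn_bound => n; apply: bound_q.
  apply: balr_copy tonal_r _ n; apply: leq_trans le_r _.
  by rewrite -divn2 leq_div.
split; last first.
  move=> omni; exists q.+1; split=> //; apply: bigO_of_expn_bound => n.
  by apply: bound_q; apply: ot_copy.
exists q.+1; split=> //; split=> [r _|[n0 bal_lt]]; first exact: bigO_balr.
under eq_fun do rewrite bal_half.
by apply: bigO_balr => //; exists n0 => n /bal_lt; rewrite bal_half.
Qed.
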